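(* For every real $x$ with $0\le x\le \tfrac12\pi$, $$\int_0^x\log(\tan\theta)\,d\theta = -\sum_{k=0}^\infty \frac{\sin((4k+2)x)}{(2k+1)^2}.$$
   Context: The integrand has integrable logarithmic singularities at $\theta=0$ and $\theta=\pi/2$. *)

(* Defs.v *)
From mathcomp Require Export all_boot all_order all_algebra.
From mathcomp Require Export all_classical all_reals all_analysis.
Export Order.TTheory GRing.Theory Num.Theory.
Export numFieldNormedType.Exports.

(** Integrals are taken over the open interval: [tan] and [ln] are total
    functions of the library, and [ln (tan t)] takes a junk value ([0]) at the
    singular points [t = 0] and [t = pi / 2]. *)

(* Main.v *)
From mathcomp Require Import measurable_realfun ring lra.
Require Import Defs.

Set Implicit Arguments.
Unset Strict Implicit.
Unset Printing Implicit Defensive.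

Local Open Scope classical_set_scope.
Local Open Scope ring_scope.

(** The series is the termwise integral of the Fourier expansion
    [ln (tan t) = - 2 * \sum_k cos ((4 k + 2) t) / (2 k + 1)]: the partial sum
    [log_tan_sum N] of the latter is minus the derivative of the partial sum
    [sin_sum N] of the former, and [sin_sum N] vanishes at [0].  What has to be
    shown is that the expansion holds on the open interval from [0] to [pi / 2]
    and that it may be integrated up to the singular endpoints.

    Both points rest on one closed form.  The derivative of [log_tan_sum N] is
    [4 * \sum_k sin ((4 k + 2) t) = 2 (1 - cos (4 N t)) / sin (2 t)], while that
    of [ln (tan t)] is [2 / sin (2 t)]; so the error
    [ln (tan t) - log_tan_sum N t] has derivative [2 cos (4 N t) / sin (2 t)],
    and it vanishes at [pi / 4].  Two functions with a common zero, the
    derivative of one dominating that of the other, are comparable in absolute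
    value ([norm_le_of_is_derive_le]).  Applied twice, this gives
    - [norm_log_tan_error_le]: the error is at most [`|ln (tan t)|], so the
      partial sums are dominated by [2 * `|ln (tan t)|] and have the sign of
      [ln (tan t)] on either side of [pi / 4];
    - [norm_log_tan_error_le_csc]: [N] times the error is at most
      [1 / sin (2 t)], so the partial sums converge pointwise.

    Since the partial sums have constant sign on each half of the interval, the
    integral of their absolute value is a combination of values of [sin_sum N],
    which are bounded by [\sum_k 1 / (2 k + 1) ^ 2 <= 2].  Fatou's lemma then
    makes [ln (tan t)] integrable without any estimate of its singularities, and
    dominated convergence identifies its integral with the limit of
    [- sin_sum N x]. *)

(** * Comparison of functions through their derivatives *)

Section comparison.
Context {R : realType}.
Implicit Types (f g df dg : R -> R) (a b c x : R).

Lemma nondecreasing_of_is_derive_ge0 f df a b :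
  (forall x, x \in `]a, b[ -> is_derive x 1 f (df x)) ->
  (forall x, x \in `]a, b[ -> 0 <= df x) ->
  {in `]a, b[ &, {homo f : x y / x <= y}}.
Proof.
move=> Hf Hge; apply: ger0_derive1_le_oo => x xab.
- by have := Hf x xab => Hd; exact: ex_derive.
- by have := Hf x xab => Hd; rewrite derive1E derive_val; exact: Hge.
- rewrite inE in xab; have := Hf x xab => Hd.
  by apply/differentiable_continuous; rewrite -derivable1_diffP; exact: ex_derive.
Qed.

(** Both [g + f] and [g - f] are nondecreasing and vanish at [c]. *)
Lemma norm_le_of_is_derive_le f g df dg a b c :
  c \in `]a, b[ ->
  (forall x, x \in `]a, b[ -> is_derive x 1 f (df x)) ->
  (forall x, x \in `]a, b[ -> is_derive x 1 g (dg x)) ->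
  (forall x, x \in `]a, b[ -> `|df x| <= dg x) ->
  f c = 0 -> g c = 0 ->
  forall x, x \in `]a, b[ -> `|f x| <= `|g x|.
Proof.
move=> cab Hf Hg Hle fc gc x xab.
have hD : {in `]a, b[ &, {homo (fun x => g x + f x) : x y / x <= y}}.
  apply: (@nondecreasing_of_is_derive_ge0 _ (fun x => dg x + df x)) => y yab.
    by have := Hf y yab; have := Hg y yab => ? ?; exact: is_deriveD.
  by have := Hle y yab; rewrite ler_norml => /andP[]; lra.
have hB : {in `]a, b[ &, {homo (fun x => g x - f x) : x y / x <= y}}.
  apply: (@nondecreasing_of_is_derive_ge0 _ (fun x => dg x - df x)) => y yab.
    by have := Hf y yab; have := Hg y yab => ? ?; exact: is_deriveB.
  by have := Hle y yab; rewrite ler_norml => /andP[]; lra.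
have [cx|/ltW xc] := leP c x.
- have := hD c x cab xab cx; have := hB c x cab xab cx.
  rewrite fc gc /= => H1 H2.
  apply: le_trans (ler_norm _); rewrite ler_norml; apply/andP; split; lra.
- have := hD x c xab cab xc; have := hB x c xab cab xc.
  rewrite fc gc /= => H1 H2; rewrite -normrN.
  rewrite -[leRHS]normrN; apply: le_trans (ler_norm _).
  by rewrite ler_norml; apply/andP; split; lra.
Qed.

End comparison.

(** * Integrability of a limit of functions bounded in L1 *)

Section fatou_integrable.
Local Open Scope ereal_scope.
Context d (T : measurableType d) (R : realType).
Variables (mu : {measure set T -> \bar R}) (D : set T).

Lemma integrable_of_cvg_bounded (f_ : (T -> R)^nat) (f : T -> R) (M : R) :
  measurable D ->
  (forall n, measurable_fun D (f_ n)) ->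
  (forall x, D x -> (f_ n x @[n --> \oo] --> f x)%classic) ->
  (forall n, \int[mu]_(x in D) `|(f_ n x)%:E| <= M%:E) ->
  mu.-integrable D (fun x => (f x)%:E).
Proof.
move=> mD mf_ f_f fM.
have mf : measurable_fun D f by exact: (measurable_fun_cvg mf_).
apply/integrableP; split; first exact/measurable_EFinP.
apply: (@le_lt_trans _ _ M%:E); last by rewrite ltry.
have mabs n : measurable_fun D (fun x => `|(f_ n x)%:E|).
  by apply: measurableT_comp => //; exact/measurable_EFinP.
have := @fatou _ _ _ mu D mD (fun n x => `|(f_ n x)%:E|) mabs
  (fun n x _ => abse_ge0 _).
have -> : \int[mu]_(x in D) limn_einf (fun n => `|(f_ n x)%:E|) =
          \int[mu]_(x in D) `|(f x)%:E|.
  apply: eq_integral => x; rewrite inE => Dx.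
  suff /cvg_limn_einf_sup[] : (`|(f_ n x)%:E| @[n --> \oo] --> `|(f x)%:E|)%classic by [].
  by apply: cvg_abse; apply/fine_cvgP; split; [exact: nearW|exact: f_f].
move/le_trans; apply.
rewrite limn_einf_lim; apply: lime_le; first exact: is_cvg_einfs.
apply: nearW => n; apply: le_trans (fM n).
by apply: ereal_inf_lbound; exists n => /=.
Qed.

End fatou_integrable.

(** * Trigonometric partial sums *)

Section partial_sums.
Context {R : realType}.
Implicit Types (t x : R) (k N : nat).

Definition log_tan_sum N t : R :=
  - \sum_(k < N) 2 * cos ((4 * k + 2)%N%:R * t) / (2 * k + 1)%N%:R.

Definition sin_sum N x : R :=
  \sum_(k < N) sin ((4 * k + 2)%N%:R * x) / (2 * k + 1)%N%:R ^+ 2.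

Lemma odd_neq0 k : (2 * k + 1)%N%:R != 0 :> R.
Proof. by rewrite pnatr_eq0 addn1. Qed.

Lemma is_derive_sum_nat N (h : nat -> R -> R) (dh : nat -> R) x :
  (forall k, is_derive x 1 (h k) (dh k)) ->
  is_derive x 1 (fun y => \sum_(k < N) h k y) (\sum_(k < N) dh k).
Proof.
move=> H.
rewrite (_ : (fun _ => _) = \sum_(k < N) h k); last first.
  by apply/funext => y; rewrite fct_sumE.
exact: is_derive_sum.
Qed.

Lemma is_derive_mull (a : R) x : is_derive x 1 (fun y => a * y) a.
Proof.
by have := is_deriveZ a (is_derive_id x (1 : R)); rewrite /GRing.scale /= mulr1.
Qed.

Lemma is_derive_sin_mull (a : R) x :
  is_derive x 1 (fun y => sin (a * y)) (a * cos (a * x)).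
Proof.
have H := is_derive_mull a x.
apply: (is_derive_eq (@is_derive1_comp _ _ _ _ _ _ (is_derive_sin _) H)).
by rewrite mulrC.
Qed.

Lemma is_derive_cos_mull (a : R) x :
  is_derive x 1 (fun y => cos (a * y)) (- (a * sin (a * x))).
Proof.
have H := is_derive_mull a x.
apply: (is_derive_eq (@is_derive1_comp _ _ _ _ _ _ (is_derive_cos _) H)).
by rewrite mulNr mulrC.
Qed.

Lemma is_derive_sin_sum N x :
  is_derive x 1 (sin_sum N) (- log_tan_sum N x).
Proof.
rewrite opprK; apply: (@is_derive_sum_nat _
  (fun k y => sin ((4 * k + 2)%N%:R * y) / (2 * k + 1)%N%:R ^+ 2)
  (fun k => 2 * cos ((4 * k + 2)%N%:R * x) / (2 * k + 1)%N%:R) _) => k.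
have Hs := is_derive_sin_mull (4 * k + 2)%N%:R x.
have -> : (fun y : R => sin ((4 * k + 2)%N%:R * y) / (2 * k + 1)%N%:R ^+ 2) =
  ((2 * k + 1)%N%:R ^- 2) \*: (fun y => sin ((4 * k + 2)%N%:R * y)).
  by apply/funext => y /=; rewrite mulrC.
apply: is_derive_eq; rewrite /GRing.scale /=.
have := odd_neq0 k.
by rewrite !(natrD, natrM) => ?; field.
Qed.

Lemma is_derive_log_tan_sum N t :
  is_derive t 1 (log_tan_sum N) (\sum_(k < N) 4 * sin ((4 * k + 2)%N%:R * t)).
Proof.
rewrite -[X in is_derive _ _ _ X]opprK -sumrN; apply: is_deriveN.
apply: (@is_derive_sum_nat _
  (fun k y => 2 * cos ((4 * k + 2)%N%:R * y) / (2 * k + 1)%N%:R)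
  (fun k => - (4 * sin ((4 * k + 2)%N%:R * t))) _) => k.
have Hs := is_derive_cos_mull (4 * k + 2)%N%:R t.
have -> : (fun y : R => 2 * cos ((4 * k + 2)%N%:R * y) / (2 * k + 1)%N%:R) =
  (2 / (2 * k + 1)%N%:R) \*: (fun y => cos ((4 * k + 2)%N%:R * y)).
  by apply/funext => y /=; rewrite mulrAC.
apply: is_derive_eq; rewrite /GRing.scale /=.
have := odd_neq0 k.
by rewrite !(natrD, natrM) => ?; field.
Qed.

(** The sum telescopes, since
    [2 sin a sin b = cos (a - b) - cos (a + b)] with [b = 2 t]. *)
Lemma sum_sin_odd_multiples N t :
  (\sum_(k < N) sin ((4 * k + 2)%N%:R * t)) * (2 * sin (2 * t)) =
  1 - cos ((4 * N)%N%:R * t).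
Proof.
elim: N => [|N IH]; first by rewrite big_ord0 muln0 !mul0r cos0 subrr.
rewrite big_ord_recr /= mulrDl IH.
have -> : (4 * N)%N%:R * t = (4 * N + 2)%N%:R * t - 2 * t.
  by rewrite natrD; ring.
have -> : (4 * N.+1)%N%:R * t = (4 * N + 2)%N%:R * t + 2 * t.
  by rewrite mulnS !natrD; ring.
rewrite cosB cosD; ring.
Qed.

Lemma sin_nat_mul_pi k : sin (k%:R * pi) = 0 :> R.
Proof.
elim: k => [|k IH]; first by rewrite mul0r sin0.
by rewrite -natr1 mulrDl mul1r sinDpi IH oppr0.
Qed.

Lemma log_tan_sum_piquarter N : log_tan_sum N (pi / 4) = 0.
Proof.
rewrite /log_tan_sum big1 ?oppr0// => k _.
have -> : (4 * k + 2)%N%:R * (pi / 4) = k%:R * pi + pi / 2 :> R.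
  by rewrite natrD natrM; field.
by rewrite cosDpihalf sin_nat_mul_pi oppr0 mulr0 mul0r.
Qed.

Lemma sin_double_gt0 t : t \in `]0, pi / 2[ -> 0 < sin (2 * t).
Proof.
rewrite in_itv /= => /andP[t0 t1]; apply: sin_gt0_pi; apply/andP; split; lra.
Qed.

(** * The error of the expansion of [ln (tan t)] *)

Lemma piquarter_in : pi / 4 \in `]0 : R, pi / 2[.
Proof. by have := pi_gt0 R; rewrite in_itv /= => ?; apply/andP; split; lra. Qed.

Lemma is_derive_ln_tan t : t \in `]0, pi / 2[ ->
  is_derive t 1 (fun y => ln (tan y)) (2 / sin (2 * t)).
Proof.
rewrite in_itv /= => /andP[t0 t1].
have c0 : 0 < cos t by apply: cos_gt0_pihalf; apply/andP; split; lra.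
have s0 : 0 < sin t by apply: sin_gt0_pihalf; apply/andP; split; lra.
have tan0 : 0 < tan t by rewrite divr_gt0.
have c0' : cos t != 0 by rewrite gt_eqF.
apply: (is_derive_eq (@is_derive1_comp _ _ _ _ _ _ (is_derive1_ln tan0) (is_derive_tan c0'))).
rewrite (_ : 2 * t = t *+ 2) ?mulr_natl// sin_mulr2n /tan.
by field; rewrite c0' gt_eqF.
Qed.

(** The [1] in the closed form of the sum of sines cancels the derivative of
    [ln (tan t)], leaving a purely oscillating term. *)
Lemma is_derive_log_tan_error N t : t \in `]0, pi / 2[ ->
  is_derive t 1 (fun y => ln (tan y) - log_tan_sum N y)
    (2 * cos ((4 * N)%N%:R * t) / sin (2 * t)).
Proof.
move=> tI; have s0 := sin_double_gt0 tI.
have H1 := is_derive_ln_tan tI; have H2 := is_derive_log_tan_sum N t.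
apply: (is_derive_eq (is_deriveB H1 H2)).
rewrite -mulr_sumr.
have -> : \sum_(i < N) sin ((4 * i + 2)%N%:R * t) =
   (1 - cos ((4 * N)%N%:R * t)) / (2 * sin (2 * t)).
  by rewrite -sum_sin_odd_multiples mulfK// mulf_neq0// gt_eqF.
by field; rewrite gt_eqF.
Qed.

Lemma log_tan_error_piquarter N : ln (tan (pi / 4)) - log_tan_sum N (pi / 4) = 0.
Proof. by rewrite tan_piquarter ln1 log_tan_sum_piquarter subrr. Qed.

(** Bounding the cosine in the derivative of the error by [1] leaves the
    derivative of [ln (tan t)]. *)
Lemma norm_log_tan_error_le N t : t \in `]0, pi / 2[ ->
  `|ln (tan t) - log_tan_sum N t| <= `|ln (tan t)|.
Proof.
apply: (norm_le_of_is_derive_le piquarter_in (is_derive_log_tan_error N) is_derive_ln_tan).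
- move=> y yI; have s0 := sin_double_gt0 yI.
  rewrite -mulrA mulrCA normrM [X in _ * X]gtr0_norm ?divr_gt0//.
  by rewrite ler_piMl ?cos_max// ltW// divr_gt0.
- exact: log_tan_error_piquarter.
- by rewrite tan_piquarter ln1.
Qed.

Lemma is_derive_cot2 t : t \in `]0, pi / 2[ ->
  is_derive t 1 (fun y => - (cos (2 * y) / sin (2 * y))) (2 / sin (2 * t) ^+ 2).
Proof.
move=> tI; have s0 := sin_double_gt0 tI; have s0' : sin (2 * t) != 0 by rewrite gt_eqF.
have Hc := is_derive_cos_mull 2 t; have Hs := is_derive_sin_mull 2 t.
have Hv := is_deriveV s0' Hs.
apply: (is_derive_eq (is_deriveN (is_deriveM Hc Hv))); rewrite /GRing.scale /=.
transitivity (2 * (cos (2 * t) ^+ 2 + sin (2 * t) ^+ 2) / sin (2 * t) ^+ 2).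
  by field.
by rewrite cos2Dsin2 mulr1.
Qed.

(** An integration by parts in differential form: subtracting the boundary term
    [sin (4 N t) / sin (2 t)] from [2 N] times the error removes the factor [N]
    from the derivative, which is then dominated by that of
    [- cos (2 t) / sin (2 t)]. *)
Lemma norm_log_tan_error_le_csc N t : t \in `]0, pi / 2[ ->
  N%:R * `|ln (tan t) - log_tan_sum N t| <= (sin (2 * t))^-1.
Proof.
move=> tI.
pose f y := (2 * N%:R) * (ln (tan y) - log_tan_sum N y)
            - sin ((4 * N)%N%:R * y) / sin (2 * y).
pose g y := - (cos (2 * y) / sin (2 * y)) : R.
have pi2 : 2 * (pi / 4) = pi / 2 :> R by field.
have fle : `|f t| <= `|g t|.
  apply: (@norm_le_of_is_derive_le _ f g
    (fun y => 2 * sin ((4 * N)%N%:R * y) * cos (2 * y) / sin (2 * y) ^+ 2)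
    (fun y => 2 / sin (2 * y) ^+ 2) 0 (pi / 2) (pi / 4)) => //.
  - exact: piquarter_in.
  - move=> y yI; have s0 := sin_double_gt0 yI.
    have s0' : sin (2 * y) != 0 by rewrite gt_eqF.
    have HE := is_derive_log_tan_error N yI.
    have Hv := is_deriveV s0' (is_derive_sin_mull 2 y).
    have Hs := is_derive_sin_mull (4 * N)%N%:R y.
    apply: (is_derive_eq (is_deriveB (is_deriveZ (2 * N%:R) HE) (is_deriveM Hs Hv))).
    by rewrite /GRing.scale /= natrM; field.
  - exact: is_derive_cot2.
  - move=> y yI; have s0 := sin_double_gt0 yI.
    rewrite normrM [X in _ * X]gtr0_norm ?invr_gt0 ?exprn_gt0//.
    rewrite ler_pM2r ?invr_gt0 ?exprn_gt0// !normrM normr_nat.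
    rewrite -mulrA ler_piMr// mulr_ile1//; [exact: sin_max|exact: cos_max].
  - rewrite /f log_tan_error_piquarter mulr0 sub0r.
    rewrite (_ : (4 * N)%N%:R * (pi / 4) = N%:R * pi).
      by rewrite sin_nat_mul_pi mul0r oppr0.
    by rewrite natrM; field.
  - by rewrite /g pi2 cos_pihalf mul0r oppr0.
have s0 := sin_double_gt0 tI.
have gle : `|g t| <= (sin (2 * t))^-1.
  rewrite /g normrN normrM [X in _ * X]gtr0_norm ?invr_gt0//.
  by rewrite ler_piMl ?cos_max// invr_ge0 ltW.
have sle : `|sin ((4 * N)%N%:R * t) / sin (2 * t)| <= (sin (2 * t))^-1.
  rewrite normrM [X in _ * X]gtr0_norm ?invr_gt0//.
  by rewrite ler_piMl ?sin_max// invr_ge0 ltW.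
have : `|(2 * N%:R) * (ln (tan t) - log_tan_sum N t)| <=
  `|f t| + `|sin ((4 * N)%N%:R * t) / sin (2 * t)|.
  by apply: le_trans (ler_normD _ _); rewrite /f subrK.
rewrite !normrM !normr_nat; move: fle gle sle; rewrite normrM; lra.
Qed.

Lemma cvg_log_tan_sum t : t \in `]0, pi / 2[ ->
  log_tan_sum N t @[N --> \oo] --> ln (tan t).
Proof.
move=> tI; have s0 := sin_double_gt0 tI.
rewrite -cvg_shiftS /=; apply/cvgrPdist_le => e e0.
near=> N.
have := norm_log_tan_error_le_csc N.+1 tI.
rewrite mulrC -ler_pdivlMr ?ltr0n// => /le_trans; apply.
rewrite ler_pdivrMr ?ltr0n// -ler_pdivrMl//.
near: N.
have : (N.+1%:R : R) @[N --> \oo] --> +oo.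
  by rewrite (cvg_shiftS (fun N => N%:R : R)); exact: cvgr_idn.
move/cvgryPge; exact.
Unshelve. all: by end_near. Qed.

(** * Integrals of the partial sums *)

Lemma continuous_log_tan_sum N : continuous (log_tan_sum N).
Proof.
move=> t; have H := is_derive_log_tan_sum N t.
by apply/differentiable_continuous; rewrite -derivable1_diffP; exact: ex_derive.
Qed.

Lemma measurable_log_tan_sum N (D : set R) : measurable_fun D (log_tan_sum N).
Proof.
apply: measurable_funTS.
exact: continuous_measurable_fun (@continuous_log_tan_sum N).
Qed.

Lemma continuous_sin_sum N : continuous (sin_sum N).
Proof.
move=> t; have H := is_derive_sin_sum N t.
by apply/differentiable_continuous; rewrite -derivable1_diffP; exact: ex_derive.
Qed.

Lemma integral_log_tan_sum N (a b : R) : a <= b ->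
  (\int[lebesgue_measure]_(t in `]a, b[) (log_tan_sum N t)%:E =
   (sin_sum N a - sin_sum N b)%:E)%E.
Proof.
rewrite le_eqVlt => /predU1P[<-|ab].
  by rewrite set_itvoo0 integral_set0 subrr.
rewrite -(integral_itv_bndoo true false); last first.
  by apply/measurable_EFinP; exact: measurable_log_tan_sum.
rewrite (@continuous_FTC2 _ _ (fun x => - sin_sum N x))//.
- by rewrite -EFinB opprK addrC.
- by apply: continuous_subspaceT; exact: continuous_log_tan_sum.
- have cS : continuous (fun x => - sin_sum N x).
    by move=> x; apply: cvgN; exact: continuous_sin_sum.
  split; [|exact/cvg_at_right_filter/cS|exact/cvg_at_left_filter/cS].
  move=> x _; have H := is_deriveN (is_derive_sin_sum N x); exact: ex_derive.
- move=> x _; have H := is_deriveN (is_derive_sin_sum N x).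
  by rewrite derive1E (@derive_val _ _ _ _ _ _ _ H) opprK.
Qed.

Lemma norm_sin_sum_le2 N x : `|sin_sum N x| <= 2.
Proof.
(* 1 / (2 N + 1) ^ 2 <= 2 / ((N + 1) (N + 2)), whose sum telescopes. *)
suff : `|sin_sum N x| <= 2 - 2 / N.+1%:R.
  by move/le_trans; apply; rewrite gerBl divr_ge0.
rewrite /sin_sum; elim: N => [|N IH].
  by rewrite big_ord0 normr0 divr1 subrr.
rewrite big_ord_recr /=; apply: le_trans (ler_normD _ _) _.
have : `|sin ((4 * N + 2)%N%:R * x) / (2 * N + 1)%N%:R ^+ 2| <=
   (2 * N + 1)%N%:R ^- 2.
  rewrite normrM [X in _ * X]ger0_norm ?invr_ge0 ?exprn_ge0//.
  by rewrite ler_piMl ?sin_max// invr_ge0 exprn_ge0.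
have : (2 * N + 1)%N%:R ^- 2 <= 2 / N.+1%:R - 2 / N.+2%:R :> R.
  have -> : 2 / N.+1%:R - 2 / N.+2%:R = (N.+1%:R * N.+2%:R / 2)^-1 :> R.
    by rewrite -!natr1; field; rewrite !natr1 !pnatr_eq0.
  rewrite lef_pV2 ?posrE ?exprn_gt0 ?divr_gt0 ?mulr_gt0 ?ltr0n ?addn1//.
  rewrite -[N.+2%:R]natr1 -[N.+1%:R]natr1 -[(2 * N).+1%:R]natr1 natrM.
  by have : 0 <= N%:R :> R by []; nra.
move=> H1 H2; apply: le_trans (lerD IH H2) _.
by move: H1; move: (2 / _) (2 / _) => a b; lra.
Qed.

Lemma log_tan_sum_le0 N t : t \in `]0, pi / 4] -> log_tan_sum N t <= 0.
Proof.
rewrite in_itv /= => /andP[t0 t4]; have pi0 := pi_gt0 R.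
have tI : t \in `]0, pi / 2[ by rewrite in_itv /= t0; lra.
have : ln (tan t) <= 0.
  apply: ln_le0; rewrite -tan_piquarter leNgt ltr_tan ?in_itv /=.
  - by rewrite -leNgt.
  - by apply/andP; split; lra.
  - by apply/andP; split; lra.
move=> l0; have := norm_log_tan_error_le N tI.
by rewrite (ler0_norm l0) ler_norml => /andP[]; lra.
Qed.

Lemma log_tan_sum_ge0 N t : t \in `[pi / 4, pi / 2[ -> 0 <= log_tan_sum N t.
Proof.
rewrite in_itv /= => /andP[t4 t2]; have pi0 := pi_gt0 R.
have tI : t \in `]0, pi / 2[ by rewrite in_itv /= t2 andbT; lra.
have : 0 <= ln (tan t).
  apply: ln_ge0; rewrite -tan_piquarter leNgt ltr_tan ?in_itv /=.
  - by rewrite -leNgt.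
  - by apply/andP; split; lra.
  - by apply/andP; split; lra.
move=> l0; have := norm_log_tan_error_le N tI.
by rewrite (ger0_norm l0) ler_norml => /andP[]; lra.
Qed.

(** Splitting at [pi / 4], where the partial sum changes sign, turns the integral
    into [2 * sin_sum N (pi / 4) - sin_sum N 0 - sin_sum N (pi / 2)], four values
    of [sin_sum N], each at most [2] in absolute value. *)
Lemma integral_norm_log_tan_sum_le8 N :
  (\int[lebesgue_measure]_(t in `]0%R, (pi / 2)%R[) `|log_tan_sum N t|%:E
   <= 8%:E)%E.
Proof.
have pi0 := pi_gt0 R.
have mabs (D : set R) : measurable_fun D (fun t => `|log_tan_sum N t|%:E).
  apply/measurable_EFinP; apply: measurableT_comp => //.
  exact: measurable_log_tan_sum.
rewrite (@itv_bndbnd_setU _ _ _ (BRight (pi / 4)))//=; last 2 first.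
- by rewrite bnd_simp; lra.
- by rewrite bnd_simp; lra.
rewrite integral_setU//; last 2 first.
- exact: mabs.
- apply/disj_setPS => t /= []; rewrite !in_itv /= => /andP[_ h1] /andP[h2 _].
  by move: (le_lt_trans h1 h2); rewrite ltxx.
rewrite (integral_itv_bndoo false false); last exact: mabs.
have I1 : (\int[lebesgue_measure]_(t in `]0%R, (pi / 4)%R[) (log_tan_sum N t)%:E
  = - \int[lebesgue_measure]_(t in `]0%R, (pi / 4)%R[) `|log_tan_sum N t|%:E)%E.
  rewrite -integral_ge0N//; apply: eq_integral => t; rewrite inE /= => tI.
  rewrite ler0_norm ?opprK// log_tan_sum_le0//.
  by move: tI; apply: subset_itvW.
have I2 : (\int[lebesgue_measure]_(t in `](pi / 4)%R, (pi / 2)%R[) (log_tan_sum N t)%:E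
  = \int[lebesgue_measure]_(t in `](pi / 4)%R, (pi / 2)%R[) `|log_tan_sum N t|%:E)%E.
  apply: eq_integral => t; rewrite inE /= => tI.
  rewrite ger0_norm// log_tan_sum_ge0//.
  by move: tI; apply: subset_itvW.
rewrite -[X in (X + _)%E]oppeK -I1 -I2 !integral_log_tan_sum; [|lra|lra].
rewrite -EFinN -EFinD lee_fin.
have := norm_sin_sum_le2 N 0; have := norm_sin_sum_le2 N (pi / 4).
have := norm_sin_sum_le2 N (pi / 2); rewrite !ler_norml => /andP[? ?] /andP[? ?] /andP[? ?].
lra.
Qed.

(** * Integrability and termwise integration *)

Lemma integrable_ln_tan_pihalf :
  (@lebesgue_measure R).-integrable `]0, pi / 2[ (fun t => (ln (tan t))%:E).
Proof.
apply: (@integrable_of_cvg_bounded _ _ _ lebesgue_measure _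
  log_tan_sum (fun t => ln (tan t)) 8) => //.
- by move=> N; exact: measurable_log_tan_sum.
- by move=> t /= tI; exact: cvg_log_tan_sum.
- exact: integral_norm_log_tan_sum_le8.
Qed.

Lemma integrable_ln_tan x : x <= pi / 2 ->
  (@lebesgue_measure R).-integrable `]0, x[ (fun t => (ln (tan t))%:E).
Proof.
move=> x2; apply: (@integrableS _ _ _ lebesgue_measure `]0, pi / 2[) => //.
  by apply: subset_itvl; rewrite bnd_simp.
exact: integrable_ln_tan_pihalf.
Qed.

Lemma cvg_sin_sum x : 0 <= x <= pi / 2 ->
  ((sin_sum N x)%:E @[N --> \oo] -->
    - \int[lebesgue_measure]_(t in `]0%R, x[) (ln (tan t))%:E)%E.
Proof.
move=> /andP[x0 x2].
have xS : `]0, x[ `<=` `]0, pi / 2[ by apply: subset_itvl; rewrite bnd_simp.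
have iL := integrable_ln_tan x2.
have [|||||_ _] := @dominated_convergence _ _ _ lebesgue_measure `]0, x[
  (measurable_itv _) (fun N t => (log_tan_sum N t)%:E) (fun t => (ln (tan t))%:E)
  (fun t => 2%:E * `|(ln (tan t))%:E|)%E.
- by move=> N; apply/measurable_EFinP; exact: measurable_log_tan_sum.
- exact: measurable_int iL.
- apply: aeW => t /= /xS tI; apply/fine_cvgP; split; [exact: nearW|].
  exact: cvg_log_tan_sum.
- by apply: integrableZl => //; exact: integrable_abse.
- apply: aeW => t N /xS tI; rewrite -EFinM lee_fin.
  (* the partial sum is [ln (tan t)] minus an error of at most that size *)
  have := norm_log_tan_error_le N tI.
  rewrite distrC => H; rewrite -[log_tan_sum N t](subrK (ln (tan t))).
  by apply: le_trans (ler_normD _ _) _; lra.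
rewrite /=; under eq_fun do rewrite integral_log_tan_sum//.
move/cvgeN; apply: cvg_trans; apply: near_eq_cvg; apply: nearW => N /=.
rewrite /sin_sum [X in X - _]big1 ?sub0r ?opprK// => k _.
by rewrite mulr0 sin0 mul0r.
Qed.

End partial_sums.

Theorem theorem1 (R : realType) (x : R) (hx0 : 0 <= x) (hx1 : x <= pi / 2) :
  [/\ (@lebesgue_measure R).-integrable `]0, x[ (fun t : R => (ln (tan t))%:E),
      cvgn (series (fun k : nat =>
        sin ((4 * k + 2)%N%:R * x) / (2 * k + 1)%N%:R ^+ 2 : R)) &
      (\int[@lebesgue_measure R]_(t in `]0%R, x[) (ln (tan t))%:E)%E =
      (- limn (series (fun k : nat =>
        sin ((4 * k + 2)%N%:R * x) / (2 * k + 1)%N%:R ^+ 2 : R)))%:E ].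
Proof.
have iL := integrable_ln_tan hx1.
set I := (\int[_]_(_ in _) _)%E.
have Ifin : I \is a fin_num by exact: integrable_fin_num.
have /fine_cvgP[_] : ((sin_sum N x)%:E @[N --> \oo] --> (- fine I)%:E)%E.
  by rewrite EFinN fineK//; apply: cvg_sin_sum; apply/andP.
set u := series _; have -> : fine \o (fun N => (sin_sum N x)%:E) = u.
  by apply/funext => N; rewrite /u /series /= big_mkord.
move=> cu; split => //; first by apply/cvg_ex; exists (- fine I).
by rewrite (cvg_lim _ cu)// opprK fineK.
Qed.
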